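(* Let $\delta>0$ be real, let $M>100$ be a natural number, and let $g:[0,1]\to[0,\infty)$ be continuous with $g(0)=0$ and $g(1)=M\delta$, such that for every $k\in\mathbb{N}$ the level set $\{s\in[0,1] : g(s)=k\delta\}$ is finite. Let $\mathcal{S}$ be the set of satisfied indices of $g$ at scale $\delta$. Then at least one of the following holds: either $\#\mathcal{S}\ge 0.01M$, or $g$ has a logarithmic singularity at the boundary.
   Context: Notation: $\mathbb{N}=\{0,1,2,\dots\}$, $|A|$ is the Lebesgue measure of $A$, and all intervals have positive length. For $k\in\mathbb{Z}$ put $E_k=\{s\in[0,1]: g(s)\in[k\delta,(k+1)\delta]\}$, $N_k=E_{k-1}\cup E_k\cup E_{k+1}$ and $N_k^c=[0,1]\setminus N_k$. The set of satisfied indices is $$\mathcal{S}=\{k\in\mathbb{N} : \text{there is an interval } I=(a,b)\subset[0,1] \text{ with } |E_k\cap I|>0.01|I| \text{ and } |N_k^c\cap I|>0.01|I|\}.$$ For $0<\alpha<1$ and $k\in\mathbb{Z}$, an interval $I\subset[0,1]$ is $\alpha$-full for $k$ if $|E_k\cap I|>\alpha|I|$, and $\alpha$-empty for $k$ if $|N_k^c\cap I|>\alpha|I|$. The function $g$ has a logarithmic singularity at the boundary if there exist an integer $m>0.1M$, integers $k_0<k_1<\cdots<k_m$ and lengths $\tau_0,\dots,\tau_m\in(0,1]$ with $\tau_0>3\tau_1>\cdots>3^m\tau_m$, such that one of the following holds: (Growth near 1) for every $i$, the interval $(1-\tau_i,1)$ is $0.03$-full for $k_i$, and the interval $(0,\tau_i)$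 is $0.03$-empty for each of the indices $k_i-M-1$, $k_i-M$, $k_i-M+1$; (Growth near 0) for every $i$, the interval $(0,\tau_{m-i})$ is $0.03$-full for $k_i$, and the interval $(1-\tau_{m-i},1)$ is $0.03$-empty for each of the indices $k_i+M-1$, $k_i+M$, $k_i+M+1$. *)

(* Defs.v *)
From HB Require Import structures.
From mathcomp Require Import all_boot all_order all_algebra.
From mathcomp Require Import all_classical all_reals all_analysis.
Import Order.TTheory GRing.Theory Num.Theory.
Import numFieldNormedType.Exports.

Set Implicit Arguments.
Unset Strict Implicit.
Unset Printing Implicit Defensive.

Local Open Scope classical_set_scope.
Local Open Scope ring_scope.

(* A function on [0,1] is represented by a total g : R -> R; every definition
   below only looks at its values on `[0, 1]. *)

Definition level_band (R : realType) (g : R -> R) (delta : R) (k : int) :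
    set R :=
  [set s | s \in `[0, 1] /\
           g s \in `[k%:~R * delta, (k + 1)%:~R * delta]].

Definition level_nbhd (R : realType) (g : R -> R) (delta : R) (k : int) :
    set R :=
  level_band g delta (k - 1) `|` level_band g delta k
    `|` level_band g delta (k + 1).

Definition level_far (R : realType) (g : R -> R) (delta : R) (k : int) :
    set R :=
  `[0, 1]%classic `\` level_nbhd g delta k.

Definition full (R : realType) (g : R -> R) (delta alpha : R) (k : int)
    (I : set R) : Prop :=
  (alpha%:E * lebesgue_measure I <
   lebesgue_measure (level_band g delta k `&` I))%E.

Definition empty (R : realType) (g : R -> R) (delta alpha : R) (k : int)
    (I : set R) : Prop :=
  (alpha%:E * lebesgue_measure I <
   lebesgue_measure (level_far g delta k `&` I))%E.

Definition satisfied (R : realType) (g : R -> R) (delta : R) : set nat :=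
  [set k : nat | exists a b : R,
    [/\ a < b,
        `]a, b[%classic `<=` `[0, 1]%classic,
        full g delta (1 / 100) k%:Z `]a, b[%classic &
        empty g delta (1 / 100) k%:Z `]a, b[%classic]].

Definition growth_near_1 (R : realType) (g : R -> R) (delta : R) (M m : nat)
    (k : 'I_m.+1 -> int) (tau : 'I_m.+1 -> R) : Prop :=
  forall i : 'I_m.+1,
    full g delta (3 / 100) (k i) `](1 - tau i), 1[%classic /\
    [/\ empty g delta (3 / 100) (k i - M%:Z - 1) `]0, (tau i)[%classic,
        empty g delta (3 / 100) (k i - M%:Z) `]0, (tau i)[%classic &
        empty g delta (3 / 100) (k i - M%:Z + 1) `]0, (tau i)[%classic].

(* rev_ord i has value m - i. *)
Definition growth_near_0 (R : realType) (g : R -> R) (delta : R) (M m : nat)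
    (k : 'I_m.+1 -> int) (tau : 'I_m.+1 -> R) : Prop :=
  forall i : 'I_m.+1,
    let t := tau (rev_ord i) in
    full g delta (3 / 100) (k i) `]0, t[%classic /\
    [/\ empty g delta (3 / 100) (k i + M%:Z - 1) `](1 - t), 1[%classic,
        empty g delta (3 / 100) (k i + M%:Z) `](1 - t), 1[%classic &
        empty g delta (3 / 100) (k i + M%:Z + 1) `](1 - t), 1[%classic].

Definition log_singularity (R : realType) (g : R -> R) (delta : R) (M : nat) :
    Prop :=
  exists (m : nat) (k : 'I_m.+1 -> int) (tau : 'I_m.+1 -> R),
    [/\ M%:R / 10 < m%:R :> R,
        forall i j : 'I_m.+1, (i < j)%N -> k i < k j,
        forall i : 'I_m.+1, 0 < tau i <= 1,
        forall i j : 'I_m.+1, (i < j)%N -> 3 ^+ j * tau j < 3 ^+ i * tau i &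
        growth_near_1 g delta M k tau \/ growth_near_0 g delta M k tau].

(* Main.v *)
Require Import Defs.
From HB Require Import structures.
From mathcomp Require Import all_boot all_order all_algebra.
From mathcomp Require Import all_classical all_reals all_analysis.
From mathcomp Require Import measurable_realfun zify ring lra.
Import Order.TTheory GRing.Theory Num.Theory.
Import numFieldNormedType.Exports.

(** Why the theorem holds.  Level sets being null, all the measures involved
    are differences of the lengths l k a b = |{g < k delta} /\ (a, b)|: the band
    E_k meets (a, b) in length l (k+1) - l k, and the part of (a, b) lying below
    E_k, resp. above it, has length l k, resp. (b - a) - l (k+1).

    Suppose that fewer than M/100 indices are satisfied, and call k quiet when
    neither k nor k+1 is satisfied.  Then every interval I, for a quiet k, lies
    almost entirely (up to 2%) on one side of E_k: either at most 2% of I is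
    below E_k or at most 2% of I is above it ([quiet_dichotomy]).  Indeed, an
    interval with more than 2% on both sides contains another one half as long
    ([mixed_half]), and repeating this contradicts the continuity of g.

    Consequently, when an interval (0, t) is as much below E_k as above it, E_k
    fills at least 96% of it.  Let t grow from 0 to 1.  At first (0, t) is below
    E_k for every k >= 1.  If it ends up mostly above E_k, take the last t at
    which both sides balance: E_k fills (0, t), and these times increase with k
    by a factor more than 3, because a band that fills an interval leaves no
    room for the next one ([last_balance_sep]).  The same can be said of the
    intervals (1 - t, 1), which start above E_k when k <= M - 3 and may end up
    mostly below it.  As (0, 1) is mostly above E_k or mostly below it, every
    quiet k from 1 to M - 3 is balanced at one of the two ends, hence one end
    gets about half of them, which is far more than M/10.

    There remains the emptiness condition at the opposite end.  Near 1 it is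
    automatic for k <= M - 3, but near 0 it may fail.  So let k0 be the largest
    quiet index whose last balance at 0, at time t0 say, comes without emptiness
    at 1: then (0, t0) is at level k0 while (1 - t0, 1) is about M levels higher
    ([barrier]).  For k0 < k <= k0 + M - 3 the above argument applies again.  An
    index balanced at 0 meets the emptiness condition, as k > k0.  An index
    balanced at 1 is so at a time t >= t0, since (1 - t0, 1) is still above E_k,
    and for those t the interval (0, t) is above E_k0, hence above the levels
    close to k - M. *)

Set Implicit Arguments.
Unset Strict Implicit.
Unset Printing Implicit Defensive.

Local Open Scope classical_set_scope.
Local Open Scope ring_scope.

(** * Last zeros of Lipschitz functions *)

(** Besides the zero of the intermediate value theorem, the strict sign after it
    is what makes last balance times comparable for different levels. *)
Lemma last_zero (R : realType) (f : R -> R) (C a b : R) :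
  0 < C -> a <= b ->
  (forall x y, a <= x -> x <= y -> y <= b -> `|f x - f y| <= C * (y - x)) ->
  0 <= f a -> f b <= 0 ->
  exists s, [/\ a <= s <= b, f s = 0 & forall t, s < t -> t <= b -> f t < 0].
Proof.
move=> C0 ab lipf fa fb.
pose S := [set t | a <= t <= b /\ 0 <= f t].
have Sa : S a by split => //; rewrite lexx ab.
have ubS : ubound S b by move=> t [/andP[]].
have supS : has_sup S by split; [exists a | exists b].
have le_sup t : S t -> t <= sup S by move=> St; apply: ub_le_sup => //; exists b.
have as_ : a <= sup S by exact: le_sup.
have sb : sup S <= b by apply: ge_sup => //; exists a.
exists (sup S); split; first by rewrite as_ sb.
- apply/eqP; rewrite eq_le; apply/andP; split.
  + rewrite leNgt; apply/negP => fs.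
    have sltb : sup S < b.
      rewrite lt_neqAle sb andbT; apply/eqP => e; move: fs; rewrite e; lra.
    pose t := Num.min b (sup S + f (sup S) / C).
    have d0 : 0 < f (sup S) / C by exact: divr_gt0.
    have st : sup S < t by rewrite /t lt_min sltb ltrDl.
    have tb : t <= b by rewrite /t ge_min lexx.
    have ts : t - sup S <= f (sup S) / C.
      by rewrite lerBlDl /t ge_min lexx orbT.
    have : S t.
      split; first by rewrite tb andbT (le_trans as_) // ltW.
      have := lipf _ _ as_ (ltW st) tb.
      have : C * (t - sup S) <= f (sup S) by rewrite mulrC -ler_pdivlMr.
      by rewrite ler_norml => h /andP[_ h']; lra.
    by move/le_sup; rewrite leNgt st.
  + rewrite leNgt; apply/negP => fs.
    have d0 : 0 < - f (sup S) / C by rewrite divr_gt0 // oppr_gt0.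
    have [t St lt] := sup_adherent d0 supS.
    have ts := le_sup _ St.
    case: St => /andP[at_ tb] ft.
    have := lipf _ _ at_ ts sb.
    have : C * (sup S - t) < - f (sup S).
      by rewrite mulrC -ltr_pdivlMr //; lra.
    by rewrite ler_norml => h /andP[_ h']; lra.
- move=> t st tb; rewrite ltNge; apply/negP => ft.
  have : S t by split => //; rewrite tb andbT (le_trans as_) // ltW.
  by move/le_sup; rewrite leNgt st.
Qed.

(** * Level profiles and the dichotomy for quiet levels *)

(** The properties of l k a b = |{g < k delta} /\ (a, b)| on which the
    combinatorics rests.  [profile_local] is the uniform continuity of g: on a
    short interval, g cannot take values both below k delta and above
    (k+1) delta.  [profile_left] and [profile_right] record g 0 = 0 and
    g 1 = M delta, [profile_bottom] and [profile_top] that g is nonnegative and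
    bounded. *)
Record level_profile (R : realType) (M : nat) (l : int -> R -> R -> R) :
    Prop := LevelProfile {
  profile_ge0 : forall k a b, 0 <= a -> a <= b -> b <= 1 -> 0 <= l k a b;
  profile_le_len : forall k a b,
    0 <= a -> a <= b -> b <= 1 -> l k a b <= b - a;
  profile_mono : forall k k' a b,
    0 <= a -> a <= b -> b <= 1 -> k <= k' -> l k a b <= l k' a b;
  profile_add : forall k a b c,
    0 <= a -> a <= b -> b <= c -> c <= 1 -> l k a c = l k a b + l k b c;
  profile_local : exists2 e, 0 < e & forall k a b,
    0 <= a -> a <= b -> b <= 1 -> b - a < e ->
    l k a b = 0 \/ l (k + 1) a b = b - a;
  profile_bottom : forall a b, 0 <= a -> a <= b -> b <= 1 -> l 0 a b = 0;
  profile_top : exists K : nat, l K%:Z 0 1 = 1;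
  profile_left : exists2 e, 0 < e <= 1 & l 1 0 e = e;
  profile_right : exists2 e, 0 < e <= 1 & l (M%:Z - 1) (1 - e) 1 = 0
}.

Arguments profile_ge0 {R M l} _ k a b.
Arguments profile_le_len {R M l} _ k a b.
Arguments profile_mono {R M l} _ k k' a b.
Arguments profile_add {R M l} _ k a b c.

(** In terms of a profile, that k is not a satisfied index: the left-hand sides
    are the lengths of E_k and of the complement of N_k in (a, b). *)
Definition unseen_or_near (R : realType) (l : int -> R -> R -> R) (k : int) :=
  forall a b : R, 0 <= a -> a < b -> b <= 1 ->
    l (k + 1) a b - l k a b <= (b - a) / 100 \/
    l (k - 1) a b + (b - a - l (k + 2) a b) <= (b - a) / 100.

Definition quiet (R : realType) (l : int -> R -> R -> R) (k : int) :=
  unseen_or_near l k /\ unseen_or_near l (k + 1).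

Section Dichotomy.
Context (R : realType) (M : nat) (l : int -> R -> R -> R).
Hypothesis (lP : level_profile M l).

(** If more than 2% lay on each side of E_k while E_k is visible, then by
    non-satisfaction of k more than 1% would be in E_(k-1), and likewise in
    E_(k+1); but E_(k-1) is far from E_(k+1), so k+1 would be satisfied. *)
Lemma quiet_seen (k : int) (a b : R) : quiet l k -> 0 <= a -> a < b -> b <= 1 ->
  l (k + 1) a b - l k a b <= (b - a) / 100 \/
  l k a b <= (b - a) / 50 \/ b - a - l (k + 1) a b <= (b - a) / 50.
Proof.
move=> [u0 u1] a0 ab b1.
have [|far0] := u0 a b a0 ab b1; first by left.
right.
have ab' := ltW ab.
have := u1 a b a0 ab b1.
have -> : k + 1 + 1 = k + 2 by lia.
have -> : k + 1 - 1 = k by lia.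
have -> : k + 1 + 2 = k + 3 by lia.
have g1 := profile_ge0 lP (k - 1) a b a0 ab' b1.
have g2 := profile_le_len lP (k + 2) a b a0 ab' b1.
have g3 := profile_le_len lP (k + 3) a b a0 ab' b1.
by case=> h; lra.
Qed.

Lemma profile_shift_lip (k : int) (a b r x y : R) :
  0 <= a -> b + r <= 1 -> 0 <= r ->
  a <= x -> x <= y -> y <= b ->
  `|l k x (x + r) - l k y (y + r)| <= 2 * (y - x).
Proof.
move=> a0 br r0 ax xy yb.
have [x0 y1] : 0 <= x /\ y + r <= 1 by split; lra.
have e1 : l k x (y + r) = l k x (x + r) + l k (x + r) (y + r).
  by apply: (profile_add lP) => //; lra.
have e2 : l k x (y + r) = l k x y + l k y (y + r).
  by apply: (profile_add lP) => //; lra.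
have p1 : 0 <= l k x y by apply: (profile_ge0 lP) => //; lra.
have p2 : 0 <= l k (x + r) (y + r) by apply: (profile_ge0 lP) => //; lra.
have q1 : l k x y <= y - x by apply: (profile_le_len lP) => //; lra.
have q2 : l k (x + r) (y + r) <= (y + r) - (x + r).
  by apply: (profile_le_len lP) => //; lra.
rewrite ler_norml; apply/andP; split; lra.
Qed.

Definition mixed (k : int) (a b : R) :=
  (b - a) / 50 < l k a b /\ (b - a) / 50 < b - a - l (k + 1) a b.

(** By [quiet_seen] E_k takes at most 2% of either half of the interval.  If one
    half is rather below E_k and the other rather above, a window of the same
    length sliding from one to the other is at some time balanced, hence has
    49% on each side.  Otherwise both halves lean to the same side, and the one
    with more on the other side is mixed. *)
Lemma mixed_half (k : int) (a b : R) : quiet l k -> 0 <= a -> a < b -> b <= 1 ->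
  mixed k a b ->
  exists a' b', [/\ 0 <= a', a' < b', b' <= 1, b' - a' = (b - a) / 2 &
                    mixed k a' b'].
Proof.
move=> qk a0 ab b1 [mL mH].
have eI : l (k + 1) a b - l k a b <= (b - a) / 100.
  by have [//|[]] := quiet_seen qk a0 ab b1; lra.
pose r := (b - a) / 2.
have r0 : 0 < r by rewrite /r; lra.
have br : b = a + r + r by rewrite /r; lra.
(* the excess in (x, x + r) of the part below E_k over the part above it *)
pose D (x : R) := l k x (x + r) + l (k + 1) x (x + r) - r.
have lipD (x y : R) :
    a <= x -> x <= y -> y <= a + r -> `|D x - D y| <= 4 * (y - x).
  move=> ax xy ya.
  have h j : `|l j x (x + r) - l j y (y + r)| <= 2 * (y - x).
    by apply: (@profile_shift_lip _ a (a + r)) => //; lra.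
  have := h k; have := h (k + 1).
  rewrite !ler_norml /D => /andP[? ?] /andP[? ?]; apply/andP; split; lra.
have E (x : R) : a <= x -> x <= a + r ->
    l (k + 1) x (x + r) - l k x (x + r) <= r / 50.
  move=> ax xa.
  have s j : l j a b = l j a x + l j x (x + r) + l j (x + r) b.
    rewrite (profile_add lP j a x b) //; try lra.
    by rewrite (profile_add lP j x (x + r) b) //; lra.
  have := s k; have := s (k + 1).
  have m1 : l k a x <= l (k + 1) a x.
    by apply: (profile_mono lP) => //; first [lra | lia].
  have m2 : l k (x + r) b <= l (k + 1) (x + r) b.
    by apply: (profile_mono lP) => //; first [lra | lia].
  by move: eI; rewrite /r; lra.
have balanced (x : R) : a <= x -> x <= a + r -> D x = 0 ->
   exists a' b', [/\ 0 <= a', a' < b', b' <= 1, b' - a' = (b - a) / 2 &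
                    mixed k a' b'].
  move=> ax xa D0; exists x, (x + r); have := E x ax xa; move: D0.
  rewrite /D /mixed => ? ?.
  by split; [lra|lra|lra|rewrite /r; lra|split; lra].
have sum j : l j a b = l j a (a + r) + l j (a + r) (a + r + r).
  by rewrite br (profile_add lP j a (a + r)) //; lra.
have sk := sum k; have sk1 := sum (k + 1).
have Ea : l (k + 1) a (a + r) - l k a (a + r) <= r / 50 by apply: E; lra.
have Ec : l (k + 1) (a + r) (a + r + r) - l k (a + r) (a + r + r) <= r / 50.
  by apply: E; lra.
have [Da|Da] := leP 0 (D a); have [Dc|Dc] := leP 0 (D (a + r)).
  (* both halves lean below E_k *)
- have [H1|H1] := leP (r - l (k + 1) a (a + r)) (r / 50).
  + exists (a + r), (a + r + r).
    rewrite /mixed; move: Da Dc mL mH; rewrite /D.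
    by split; [lra|lra|lra|rewrite /r; lra|split; rewrite /r in H1 *; lra].
  + exists a, (a + r).
    rewrite /mixed; move: Da Dc mL mH; rewrite /D.
    by split; [lra|lra|lra|rewrite /r; lra|split; lra].
- have [||s [/andP[as_ sa] Ds _]] := last_zero _ _ lipD Da (ltW Dc); try lra.
  exact: (balanced s).
- have [||x y ax xy ya| | |s [/andP[as_ sa] Ds _]] :=
    @last_zero R (fun x => - D x) 4 a (a + r); try lra.
  + by rewrite -opprD normrN; exact: lipD.
  + by apply: (balanced s) => //; lra.
  (* both halves lean above E_k *)
- have [L1|L1] := leP (l k a (a + r)) (r / 50).
  + exists (a + r), (a + r + r).
    rewrite /mixed; move: Da Dc mL mH; rewrite /D.
    by split; [lra|lra|lra|rewrite /r; lra|split; rewrite /r in L1 *; lra].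
  + exists a, (a + r).
    rewrite /mixed; move: Da Dc mL mH; rewrite /D.
    by split; [lra|lra|lra|rewrite /r; lra|split; lra].
Qed.

(** A mixed interval would contain mixed intervals shorter than the modulus of
    [profile_local], on which one of the two sides is absent. *)
Lemma quiet_dichotomy (k : int) (a b : R) :
  quiet l k -> 0 <= a -> a < b -> b <= 1 ->
  l k a b <= (b - a) / 50 \/ b - a - l (k + 1) a b <= (b - a) / 50.
Proof.
move=> qk a0 ab b1.
suff nm : ~ mixed k a b.
  have [?|?] := leP (l k a b) ((b - a) / 50); first by left.
  by right; rewrite leNgt; apply/negP => ?; exact: nm.
have [e e0 loc] := profile_local lP.
have [n ne] : exists n, b - a < e * 2 ^+ n.
  exists (Num.truncn ((b - a) / e)).+1.
  rewrite mulrC -ltr_pdivrMr //.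
  apply: (lt_trans (truncnS_gt _)).
  by rewrite -natrX ltr_nat ltn_expl.
elim: n a b a0 ab b1 ne => [|n IH] a b a0 ab b1 ne m.
  rewrite expr0 mulr1 in ne.
  by case: m; have [->|->] := loc k a b a0 (ltW ab) b1 ne; lra.
have [a' [b' [a'0 ab' b'1 len m']]] := mixed_half qk a0 ab b1 m.
apply: IH m' => //; move: ne; rewrite len exprS; lra.
Qed.

End Dichotomy.

(** * Balance times at an end of the unit interval *)

(** The common shape of t |-> l k 0 t and, after a reversal of the levels, of
    the intervals (1 - t, 1): w k t is the length of the part below level k of an
    interval that grows with its length t. *)
Record ladder (R : realType) (w : int -> R -> R) : Prop := Ladder {
  ladder_mono : forall k k' t,
    0 <= t -> t <= 1 -> k <= k' -> w k t <= w k' t;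
  ladder_slope : forall k s t,
    0 <= s -> s <= t -> t <= 1 -> 0 <= w k t - w k s <= t - s
}.

Arguments ladder_mono {R w} _ k k' t.
Arguments ladder_slope {R w} _ k s t.

(** As t - w (k+1) t lies above E_k, the equation says that as much of the
    interval is below E_k as above it. *)
Definition last_balance (R : realType) (w : int -> R -> R) (k : int) (t : R) :=
  [/\ 0 < t <= 1, w k t + w (k + 1) t = t &
      forall u, t < u -> u <= 1 -> w k u + w (k + 1) u < u].

(** It follows that E_k fills at least 96% of the interval of length t. *)
Definition concentrated (R : realType) (w : int -> R -> R) (k : int) (t : R) :=
  w k t <= t / 50 /\ t - w (k + 1) t <= t / 50.

Lemma last_balance_exists (R : realType) (w : int -> R -> R) (k : int) (t : R) :
  ladder w -> 0 < t <= 1 -> t <= w k t + w (k + 1) t ->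
  w k 1 + w (k + 1) 1 <= 1 ->
  exists2 s, t <= s & last_balance w k s.
Proof.
move=> wP /andP[t0 t1] wt w1.
have [||x y tx xy y1| | |s [/andP[ts s1] fs lt]] :=
  @last_zero R (fun x => w k x + w (k + 1) x - x) 3 t 1; try lra.
  have x0 : 0 <= x by lra.
  have /andP[? ?] := ladder_slope wP k x y x0 xy y1.
  have /andP[? ?] := ladder_slope wP (k + 1) x y x0 xy y1.
  rewrite ler_norml; apply/andP; split; lra.
exists s => //; split; [lra|lra|] => u su u1.
by have := lt u su u1; lra.
Qed.

(** A higher level has more below it and less above: when more is above it than
    below it, so it is for all lower levels. *)
Lemma last_balance_le (R : realType) (w : int -> R -> R) (k k' : int)
    (t t' : R) :
  ladder w -> k <= k' -> last_balance w k t -> last_balance w k' t' -> t <= t'.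
Proof.
move=> wP kk' [/andP[t0 t1] wt _] [_ _ lt]; rewrite leNgt; apply/negP => t't.
have := lt t t't t1.
have m1 : w k t <= w k' t by apply: (ladder_mono wP) => //; lra.
have m2 : w (k + 1) t <= w (k' + 1) t.
  by apply: (ladder_mono wP); [lra|lra|lia].
lra.
Qed.

(** E_k fills 96% of the interval of length t, which is contained in the one of
    length t'; but E_k is below E_k', hence takes at most 2% of the latter. *)
Lemma last_balance_sep (R : realType) (w : int -> R -> R) (k k' : int)
    (t t' : R) :
  ladder w -> k < k' -> last_balance w k t -> last_balance w k' t' ->
  concentrated w k t -> concentrated w k' t' -> 3 * t < t'.
Proof.
move=> wP kk' bt bt' [_ ct] [ct' _].
have tt' : t <= t' by apply: (last_balance_le wP) bt bt'; exact: ltW.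
case: bt bt' => /andP[t0 t1] _ _ [/andP[t'0 t'1] _ _].
have m1 : w (k + 1) t' <= w k' t' by apply: (ladder_mono wP); [lra|lra|lia].
have := ladder_slope wP (k + 1) t t' (ltW t0) tt' t'1.
lra.
Qed.

Section Profile.
Context (R : realType) (M : nat) (l : int -> R -> R -> R).
Hypothesis (lP : level_profile M l).

Definition left_end (k : int) (t : R) := l k 0 t.
Definition right_end (k : int) (t : R) := l k (1 - t) 1.
(** The part of (1 - t, 1) above level -k.  Counting from above and changing the
    sign of the level swaps the two sides of a band and preserves the order, so
    that E_k becomes the band of index -(k+1); this makes growth near 1 an
    instance of the same statements as growth near 0. *)
Definition right_end_rev (k : int) (t : R) := t - right_end (- k) t.

Lemma left_end_ladder : ladder left_end.
Proof.
rewrite /left_end; split.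
- by move=> k k' t t0 t1 kk'; exact: (profile_mono lP).
- move=> k s t s0 st t1.
  have -> : l k 0 t - l k 0 s = l k s t.
    by rewrite (profile_add lP k 0 s t) //; ring.
  by apply/andP; split; [exact: (profile_ge0 lP)|exact: (profile_le_len lP)].
Qed.

Lemma right_end_rev_ladder : ladder right_end_rev.
Proof.
rewrite /right_end_rev /right_end; split.
- move=> k k' t t0 t1 kk'.
  have : l (- k') (1 - t) 1 <= l (- k) (1 - t) 1.
    by apply: (profile_mono lP); [lra|lra|lra|lia].
  lra.
- move=> k s t s0 st t1.
  have -> : l (- k) (1 - t) 1 = l (- k) (1 - t) (1 - s) + l (- k) (1 - s) 1.
    by apply: (profile_add lP); lra.
  have : 0 <= l (- k) (1 - t) (1 - s) by apply: (profile_ge0 lP); lra.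
  have : l (- k) (1 - t) (1 - s) <= 1 - s - (1 - t).
    by apply: (profile_le_len lP); lra.
  by move=> ? ?; apply/andP; split; lra.
Qed.

Lemma concentrated_left (k : int) (t : R) :
  quiet l k -> last_balance left_end k t -> concentrated left_end k t.
Proof.
move=> qk [/andP[t0 t1] bt _]; rewrite /left_end in bt *.
have := quiet_dichotomy lP qk (lexx 0) t0 t1; rewrite /concentrated subr0.
by case=> ?; split; lra.
Qed.

Lemma right_balanceE (k : int) (t : R) :
  right_end_rev (- (k + 1)) t + right_end_rev (- (k + 1) + 1) t =
  t + t - (right_end k t + right_end (k + 1) t).
Proof.
rewrite /right_end_rev opprK.
have -> : - (- (k + 1) + 1) = k :> int by lia.
ring.
Qed.

Lemma concentrated_right (k : int) (t : R) : quiet l k ->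
  last_balance right_end_rev (- (k + 1)) t ->
  concentrated right_end_rev (- (k + 1)) t.
Proof.
move=> qk [/andP[t0 t1]].
rewrite right_balanceE /concentrated /right_end_rev opprK /right_end => bt _.
have -> : - (- (k + 1) + 1) = k :> int by lia.
have [|||?|?] := @quiet_dichotomy _ _ _ lP k (1 - t) 1 qk; try lra.
all: split; lra.
Qed.

End Profile.

(** * Extracting a logarithmic singularity from a profile *)

Section Combinatorics.
Context (R : realType) (M : nat) (l : int -> R -> R -> R).

Definition profile_full (k : int) (a b : R) :=
  3 / 100 * (b - a) < l (k + 1) a b - l k a b.

Definition profile_empty (k : int) (a b : R) :=
  3 / 100 * (b - a) < l (k - 1) a b + (b - a - l (k + 2) a b).

Hypothesis (lP : level_profile M l).

Let leftL := left_end_ladder lP.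
Let rightL := right_end_rev_ladder lP.

(** k0 is the largest index whose last balance at 0 is blocked by what happens
    at 1, with t0 its time.  That (1 - t0, 1) is almost contained in a
    neighbourhood N_(k0 + M + j), with |j| <= 1, puts it above level
    k0 + M - 2.  If no index is blocked, k0 = 0 and a small t0 do,
    since nothing is below level 0. *)
Lemma barrier : exists (k0 : nat) (t0 : R),
  [/\ 0 < t0 <= 1,
      forall t, t0 <= t -> t <= 1 -> l k0%:Z 0 t <= t / 50,
      l (k0%:Z + M%:Z - 2) (1 - t0) 1 <= 3 / 100 * t0 &
      forall k : nat, (k0 < k)%N -> quiet l k%:Z ->
        forall t, last_balance (left_end l) k%:Z t ->
        forall j : int, -1 <= j <= 1 ->
        profile_empty (k%:Z + M%:Z + j) (1 - t) 1].
Proof.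
pose blocked (k : nat) := quiet l k%:Z /\ exists t,
  last_balance (left_end l) k%:Z t /\ exists2 j : int, -1 <= j <= 1 &
  ~ profile_empty (k%:Z + M%:Z + j) (1 - t) 1.
have notblocked k : ~ blocked k -> quiet l k%:Z ->
    forall t, last_balance (left_end l) k%:Z t ->
    forall j : int, -1 <= j <= 1 ->
    profile_empty (k%:Z + M%:Z + j) (1 - t) 1.
  by move=> nb qk t bt j hj; apply: contrapT => ne; apply: nb; split => //;
    exists t; split => //; exists j.
have [[k1 bk1]|none] := pselect (exists k, blocked k); last first.
  have [e /andP[e0 e1] right0] := profile_right lP.
  exists 0%N, e; split => //.
  - by rewrite e0 e1.
  - by move=> t et t1; rewrite (profile_bottom lP) //; lra.
  - have : l (0%:Z + M%:Z - 2) (1 - e) 1 <= l (M%:Z - 1) (1 - e) 1.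
      by apply: (profile_mono lP); [lra|lra|lra|lia].
    by rewrite right0; lra.
  - by move=> k _; apply: notblocked => bk; apply: none; exists k.
(* at a blocked k, (0, 1) is at least as much above E_k as below it, whereas
   nothing of it is above level K *)
have [K topK] := profile_top lP.
have bound k : `[< blocked k >] -> (k <= K)%N.
  move=> /asboolP[_ [t [[/andP[t0 t1] bt lt] _]]].
  rewrite leqNgt; apply/negP => Kk.
  have b1 : left_end l k%:Z 1 + left_end l (k%:Z + 1) 1 <= 1.
    have [->|tlt] := eqVneq 1 t; first by rewrite bt.
    by apply/ltW/lt; rewrite // lt_neqAle eq_sym tlt.
  have m1 : l K%:Z 0 1 <= l k%:Z 0 1.
    by apply: (profile_mono lP); [lra|lra|lra|lia].
  have m2 : l K%:Z 0 1 <= l (k%:Z + 1) 0 1.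
    by apply: (profile_mono lP); [lra|lra|lra|lia].
  by move: b1; rewrite /left_end; lra.
have ex : exists k, `[< blocked k >] by exists k1; apply/asboolP.
have [k0 /asboolP[qk0 [t0 [bt0 [j hj ne]]]] maxk0] := ex_maxnP ex bound.
have [cL _] := concentrated_left lP qk0 bt0.
case: (bt0) => /andP[t00 t01] _ after.
exists k0, t0; split.
- by rewrite t00 t01.
- move=> t; rewrite le_eqVlt => /orP[/eqP<- _ //|t0t t1].
  have := after t t0t t1; rewrite /left_end.
  have t_gt0 : 0 < t by lra.
  have := quiet_dichotomy lP qk0 (lexx 0) t_gt0 t1.
  by rewrite subr0; case; lra.
- move: ne => /negP; rewrite -leNgt.
  have m1 : l (k0%:Z + M%:Z - 2) (1 - t0) 1 <=
            l (k0%:Z + M%:Z + j - 1) (1 - t0) 1.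
    by apply: (profile_mono lP); [lra|lra|lra|lia].
  have m2 : l (k0%:Z + M%:Z + j + 2) (1 - t0) 1 <= 1 - (1 - t0).
    by apply: (profile_le_len lP); lra.
  lra.
- move=> k k0k; apply: notblocked => bk.
  by have := maxk0 k; rewrite leqNgt k0k => /(_ (asboolT bk)).
Qed.

Lemma geometric_decay (tau : nat -> R) (m : nat) :
  (forall i, (i < m)%N -> 3 * tau i.+1 < tau i) ->
  forall i j, (i < j)%N -> (j <= m)%N -> 3 ^+ j * tau j < 3 ^+ i * tau i.
Proof.
move=> step i j; elim: j => // j IH; rewrite ltnS leq_eqVlt => ij jm.
have : 3 ^+ j.+1 * tau j.+1 < 3 ^+ j * tau j.
  by rewrite exprSr -mulrA ltr_pM2l ?exprn_gt0 //; exact: step.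
case/orP: ij => [/eqP -> //|ij] h; apply: (lt_trans h).
exact: IH ij (ltnW jm).
Qed.

(** The quiet levels k with k0 < k <= k0 + M - 3 are split according to whether
    (0, 1) is mainly above E_k (list A, balanced at 0) or mainly below it
    (list B, balanced at 1).  Less than 2M/100 levels of the range are not
    quiet, so one of the lists has more than M/10 + 1 entries. *)
Lemma profile_log_singularity :
  (100 < M)%N ->
  (forall u : seq nat, uniq u ->
     (forall k, k \in u -> ~ unseen_or_near l k%:Z) -> (100 * size u < M)%N) ->
  exists (m : nat) (k : 'I_m.+1 -> int) (tau : 'I_m.+1 -> R),
    [/\ M%:R / 10 < m%:R :> R,
        forall i j : 'I_m.+1, (i < j)%N -> k i < k j,
        forall i : 'I_m.+1, 0 < tau i <= 1,
        forall i j : 'I_m.+1, (i < j)%N -> 3 ^+ j * tau j < 3 ^+ i * tau i &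
        (forall i, profile_full (k i) (1 - tau i) 1 /\
           forall j : int, -1 <= j <= 1 ->
           profile_empty (k i - M%:Z + j) 0 (tau i)) \/
        (forall i, profile_full (k i) 0 (tau (rev_ord i)) /\
           forall j : int, -1 <= j <= 1 ->
           profile_empty (k i + M%:Z + j) (1 - tau (rev_ord i)) 1)].
Proof.
move=> M100 few.
have [k0 [t0 [/andP[t00 t01] low0 high0 unblocked]]] := barrier.
pose s := iota k0.+1 (M - 3).
pose q (k : nat) := `[< quiet l k%:Z >].
pose p (k : nat) := l k%:Z 0 1 + l (k%:Z + 1) 0 1 <= 1.
pose A := seq.filter p (seq.filter q s).
pose B := seq.filter (predC p) (seq.filter q s).
have sizeAB : (M <= 3 + size A + size B + 2 * (M %/ 100))%N.
  have e1 : (size A + size B = count q s)%N.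
    by rewrite !size_filter count_predC size_filter.
  have e2 : (count q s + count (predC q) s = M - 3)%N.
    by rewrite count_predC size_iota.
  pose v (k : nat) := `[< ~ unseen_or_near l k%:Z >].
  have e3 : (count (predC q) s <= count v s + count v (map S s))%N.
    rewrite count_map -count_predUI; apply: (leq_trans _ (leq_addr _ _)).
    apply: sub_count => k /=; rewrite /q /v => /asboolPn nq.
    apply/orP; have [u|u] := pselect (unseen_or_near l k%:Z).
      right; apply/asboolP => u1; apply: nq; split => //.
      by have -> : k%:Z + 1 = k.+1%:Z by lia.
    by left; apply/asboolP.
  have fewv u : uniq u -> (100 * count v u < M)%N.
    move=> uu; rewrite -size_filter; apply: few; first exact: filter_uniq.
    by move=> k; rewrite mem_filter => /andP[/asboolP].
  have f1 := fewv s (iota_uniq _ _).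
  have f2 : (100 * count v (map S s) < M)%N.
    by apply: fewv; rewrite map_inj_uniq ?iota_uniq // => ? ? [].
  lia.
have sortedf r : sorted ltn (seq.filter r (seq.filter q s)).
  apply: sorted_filter; first exact: ltn_trans.
  apply: sorted_filter; first exact: ltn_trans.
  exact: iota_ltn_sorted.
have mems r k : k \in seq.filter r (seq.filter q s) ->
    [/\ r k, quiet l k%:Z & (k0 < k <= k0 + (M - 3))%N].
  rewrite !mem_filter mem_iota => /and3P[rk /asboolP qk ks].
  by split => //; lia.
have nth_incr r m (i j : nat) : size (seq.filter r (seq.filter q s)) = m.+1 ->
    (i < j)%N -> (j <= m)%N ->
    (nth 0%N (seq.filter r (seq.filter q s)) i <
     nth 0%N (seq.filter r (seq.filter q s)) j)%N.
  move=> sz ij jm; apply: (sorted_ltn_nth ltn_trans) => //;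
    rewrite ?inE ?sz ?ltnS //; exact: leq_trans (ltnW ij) jm.
have nth_in r m (i : nat) : size (seq.filter r (seq.filter q s)) = m.+1 ->
    (i <= m)%N ->
    nth 0%N (seq.filter r (seq.filter q s)) i \in seq.filter r (seq.filter q s).
  by move=> sz im; rewrite mem_nth // sz ltnS.
have big m : (M < 10 * m)%N -> M%:R / 10 < m%:R :> R.
  by move=> h; rewrite ltr_pdivrMr // -natrM ltr_nat mulnC.
have [hA|hB] : (M < 10 * (size A).-1)%N \/ (M < 10 * (size B).-1)%N by lia.
- have [m szA] : exists m, size A = m.+1 by exists (size A).-1; lia.
  have /choice[T HT] : forall k : nat, exists t, k \in A ->
      last_balance (left_end l) k%:Z t.
    move=> k; have [kA|] := boolP (k \in A); last by exists 0.
    have [pk qk ks] := mems _ _ kA.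
    have [e /andP[e0 e1] le] := profile_left lP.
    have m1 : l 1 0 e <= l k%:Z 0 e.
      by apply: (profile_mono lP); [lra|lra|lra|lia].
    have m2 : 0 <= l (k%:Z + 1) 0 e by apply: (profile_ge0 lP); lra.
    have [||t _ bt] := last_balance_exists leftL (k := k%:Z) (t := e) _ _ pk.
    + by rewrite e0 e1.
    + by rewrite /left_end; lra.
    by exists t.
  pose a i := nth 0%N A i.
  have aA i : (i <= m)%N -> a i \in A by exact: nth_in.
  have Ta i : (i <= m)%N -> [/\ 0 < T (a i) <= 1,
      last_balance (left_end l) (a i)%:Z (T (a i)),
      quiet l (a i)%:Z, (k0 < a i)%N
      & concentrated (left_end l) (a i)%:Z (T (a i))].
    move=> im; have b := HT _ (aA i im).
    have [_ qk /andP[ks _]] := mems _ _ (aA i im).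
    by split => //; [case: b | exact: (concentrated_left lP qk)].
  (* at 0 the times increase with the level, hence the reversed order *)
  exists m, (fun i => (a i)%:Z), (fun i => T (a (m - i)%N)); split.
  + by apply: big; rewrite szA in hA.
  + move=> i j ij; rewrite ltz_nat; apply: (nth_incr _ m) => //.
    by rewrite -ltnS.
  + by move=> i; have [] := Ta (m - i)%N (leq_subr _ _).
  + move=> i j ij; apply: (@geometric_decay (fun i => T (a (m - i)%N)) m) => //.
      move=> n nm; have [|_ b1 _ _ c1] := Ta (m - n.+1)%N; first by lia.
      have [|_ b2 _ _ c2] := Ta (m - n)%N; first by lia.
      apply: (last_balance_sep leftL) b1 b2 c1 c2.
      by rewrite ltz_nat; apply: (nth_incr _ m) => //=; lia.
    by rewrite -ltnS.
  right => i /=.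
  have -> : (m - (m.+1 - i.+1) = i)%N by have := ltn_ord i; lia.
  have im : (i <= m)%N by rewrite -ltnS.
  have [/andP[T0 T1] b qk k0k [c1 c2]] := Ta i im.
  split; last by move=> j; exact: unblocked.
  by rewrite /profile_full; move: c1 c2; rewrite /left_end; lra.
- have [m szB] : exists m, size B = m.+1 by exists (size B).-1; lia.
  have /choice[T HT] : forall k : nat, exists t, k \in B -> t0 <= t /\
      last_balance (right_end_rev l) (- (k%:Z + 1)) t.
    move=> k; have [kB|] := boolP (k \in B); last by exists 0.
    have [pk qk ks] := mems _ _ kB.
    have m1 : l k%:Z (1 - t0) 1 <= l (k0%:Z + M%:Z - 2) (1 - t0) 1.
      by apply: (profile_mono lP); [lra|lra|lra|lia].
    have m2 : l (k%:Z + 1) (1 - t0) 1 <= l (k0%:Z + M%:Z - 2) (1 - t0) 1.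
      by apply: (profile_mono lP); [lra|lra|lra|lia].
    have [|||t tt bt] := last_balance_exists rightL (k := - (k%:Z + 1)) (t := t0).
    + by rewrite t00 t01.
    + by rewrite right_balanceE /right_end; lra.
    + rewrite right_balanceE /right_end subrr.
      by move: pk => /=; rewrite /p -ltNge; lra.
    by exists t.
  pose a i := nth 0%N B i.
  have aB i : (i <= m)%N -> a i \in B by exact: nth_in.
  have Ta i : (i <= m)%N -> [/\ 0 < T (a i) <= 1, t0 <= T (a i),
      last_balance (right_end_rev l) (- ((a i)%:Z + 1)) (T (a i)),
      (a i <= k0 + (M - 3))%N
      & concentrated (right_end_rev l) (- ((a i)%:Z + 1)) (T (a i))].
    move=> im; have [tt b] := HT _ (aB i im).
    have [_ qk /andP[_ ks]] := mems _ _ (aB i im).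
    by split => //; [case: b | exact: (concentrated_right lP qk)].
  exists m, (fun i => (a i)%:Z), (fun i => T (a i)); split.
  + by apply: big; rewrite szB in hB.
  + move=> i j ij; rewrite ltz_nat; apply: (nth_incr _ m) => //.
    by rewrite -ltnS.
  + by move=> i; have [] := Ta i; rewrite // -ltnS.
  + move=> i j ij; apply: (@geometric_decay (fun i => T (a i)) m) => //.
      move=> n nm; have [|_ _ b1 _ c1] := Ta n.+1; first by lia.
      have [|_ _ b2 _ c2] := Ta n; first by lia.
      apply: (last_balance_sep rightL) b1 b2 c1 c2.
      have : (a n < a n.+1)%N by apply: (nth_incr _ m).
      lia.
    by rewrite -ltnS.
  left => i.
  have im : (i <= m)%N by rewrite -ltnS.
  have [/andP[T0 T1] tt b k0k [c1 c2]] := Ta i im.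
  split.
    rewrite /profile_full; move: c1 c2; rewrite /right_end_rev opprK.
    have -> : - (- ((a i)%:Z + 1) + 1) = (a i)%:Z by lia.
    by rewrite /right_end; lra.
  move=> j hj; rewrite /profile_empty.
  have := low0 _ tt T1.
  have : l ((a i)%:Z - M%:Z + j + 2) 0 (T (a i)) <= l k0%:Z 0 (T (a i)).
    by apply: (profile_mono lP); [lra|lra|lra|lia].
  have : 0 <= l ((a i)%:Z - M%:Z + j - 1) 0 (T (a i)).
    by apply: (profile_ge0 lP); lra.
  lra.
Qed.

End Combinatorics.

(** * The profile of a continuous function *)

Lemma segment_unif_continuous (R : realType) (g : R -> R) (d : R) :
  0 < d -> {within `[0, 1]%classic, continuous g} ->
  exists2 e, 0 < e & forall s t, 0 <= s <= 1 -> 0 <= t <= 1 ->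
    `|s - t| < e -> `|g s - g t| < d.
Proof.
move=> d0 /subspace_continuousP gc.
have K : compact (`[0, 1]%classic : set R) by exact: segment_compact.
have := (compact_near_coveringP _).1 K R (0^'+)
  (fun e x => 0 <= x <= 1 -> forall t, 0 <= t <= 1 -> `|x - t| < e ->
     `|g x - g t| < d) _.
case=> [x x01|e /= e0 he].
  have d20 : 0 < d / 2 by lra.
  have /cvgrPdist_lt /(_ _ d20) := gc x x01.
  rewrite near_withinE => /nbhs_ballP[r /= r0 hr].
  exists (ball x (r / 2), [set e | 0 < e /\ e < r / 2]).
    split; first by apply: nbhsx_ballx; lra.
    near=> e; split; first by near: e; exact: nbhs_right_gt.
    by near: e; apply: nbhs_right_lt; lra.
  move=> [y e] /= [xy [e0 er]] y01 t t01 yt.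
  rewrite /ball /= in xy hr.
  have := hr y; have := hr t; rewrite !in_itv /= => ht hy.
  have : `|g x - g y| < d / 2 by apply: hy => //; lra.
  have : `|g x - g t| < d / 2.
    apply: ht => //; move: xy yt; rewrite !ltr_norml.
    by move=> /andP[? ?] /andP[? ?]; apply/andP; split; lra.
  by rewrite !ltr_norml => /andP[? ?] /andP[? ?]; apply/andP; split; lra.
exists (e / 2); first lra.
move=> s t s01 t01 st.
have e2 : ball 0 e (e / 2).
  by rewrite /ball /= sub0r normrN ger0_norm; lra.
by apply: (he (e / 2) e2 _ s) => //=; lra.
Unshelve. all: by end_near.
Qed.

Lemma lebesgue_measureU (R : realType) (A B : set R) :
  measurable A -> measurable B -> A `&` B = set0 ->
  lebesgue_measure (A `|` B) = (lebesgue_measure A + lebesgue_measure B)%E.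
Proof. by move=> mA mB AB; rewrite measureU. Qed.

Lemma lebesgue_measureU_finite (R : realType) (A B : set R) :
  measurable A -> finite_set B ->
  lebesgue_measure (A `|` B) = lebesgue_measure A.
Proof.
move=> mA /finite_set_countable cB; apply: measureU0 => //.
  by apply: countable_measurable => //; exact: measurable_set1.
exact: countable_lebesgue_measure0.
Qed.

Section Sublevels.
Context (R : realType) (delta : R) (g : R -> R).

Definition sublevel (k : int) : set R :=
  [set s | s \in `[0, 1] /\ g s < k%:~R * delta].

Definition level (k : int) : set R :=
  [set s | s \in `[0, 1] /\ g s = k%:~R * delta].

Definition sublevel_length (k : int) (a b : R) : R :=
  fine (lebesgue_measure (sublevel k `&` `]a, b[)).

Hypothesis delta_gt0 : 0 < delta.
Hypothesis g_cont : {within `[0, 1]%classic, continuous g}.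
Hypothesis g_ge0 : forall s, s \in `[0, 1] -> 0 <= g s.
Hypothesis g_level : forall k : nat,
  finite_set [set s : R | s \in `[0, 1] /\ g s = k%:R * delta].

Lemma measurable_sublevel k : measurable (sublevel k).
Proof.
have mg : measurable_fun (`[0, 1]%classic : set R) g.
  by apply: subspace_continuous_measurable_fun.
have -> : sublevel k = `[0, 1]%classic `&` g @^-1` `]-oo, k%:~R * delta[%classic.
  by apply/seteqP; split => s /=; rewrite /sublevel /= in_itv.
exact: mg.
Qed.

(** The hypothesis on level sets extends to negative k, as g is nonnegative. *)
Lemma finite_level k : finite_set (level k).
Proof.
case: k => n; first exact: g_level.
rewrite (_ : level _ = set0) //; apply/seteqP; split => // s [/g_ge0 gs gn].
move: gs; rewrite gn NegzE mulrNz mulNr oppr_ge0 leNgt.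
by rewrite mulr_gt0.
Qed.

Lemma measurable_level k : measurable (level k).
Proof.
apply: countable_measurable; first exact: measurable_set1.
by apply: finite_set_countable; exact: finite_level.
Qed.

Lemma sublevel_measureE k (a b : R) :
  lebesgue_measure (sublevel k `&` `]a, b[) = (sublevel_length k a b)%:E.
Proof.
rewrite /sublevel_length fineK // ge0_fin_numE //.
apply: (@le_lt_trans _ _ (lebesgue_measure (`]a, b[%classic : set R))).
  apply: le_measure; rewrite ?inE; [|exact: measurable_itv|exact: subIsetr].
  by apply: measurableI; [exact: measurable_sublevel|exact: measurable_itv].
by rewrite lebesgue_measure_itv /=; case: ifP => // _; rewrite -EFinD ltry.
Qed.


Lemma itv_measure (a b : R) : a <= b ->
  lebesgue_measure (`]a, b[%classic : set R) = (b - a)%:E.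
Proof.
move=> ab; rewrite lebesgue_measure_itv /= lte_fin; case: ltP => //.
move=> ba; have -> : b = a by apply/eqP; rewrite eq_le ab ba.
by rewrite subrr.
Qed.

Lemma measurable_sublevelI k (a b : R) :
  measurable (sublevel k `&` `]a, b[).
Proof. by apply: measurableI => //; exact: measurable_sublevel. Qed.

Lemma level_bandE k :
  level_band g delta k = (sublevel (k + 1) `|` level (k + 1)) `\` sublevel k.
Proof.
apply/seteqP; split => s /=; rewrite /level_band /sublevel /level /= !in_itv /=.
- move=> -[s01 /andP[h1 h2]]; split.
    by move: h2; rewrite le_eqVlt => /orP[/eqP|] h; [right|left].
  by move=> [_]; rewrite ltNge h1.
- move=> -[h nh].
  have s01 : 0 <= s <= 1 by case: h => -[].
  split => //; apply/andP; split.
    by rewrite leNgt; apply/negP => h'; apply: nh.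
  by case: h => -[_]; [exact: ltW | move=> ->].
Qed.

Lemma level_band_length k (a b : R) :
  lebesgue_measure (level_band g delta k `&` `]a, b[) =
  (sublevel_length (k + 1) a b - sublevel_length k a b)%:E.
Proof.
have mb : measurable (level_band g delta k `&` `]a, b[).
  rewrite level_bandE; apply: measurableI => //; apply: measurableD.
    by apply: measurableU; [exact: measurable_sublevel|exact: measurable_level].
  exact: measurable_sublevel.
rewrite EFinB -!sublevel_measureE.
have <- : (lebesgue_measure (level_band g delta k `&` `]a, b[) +
           lebesgue_measure (sublevel k `&` `]a, b[) =
           lebesgue_measure (sublevel (k + 1) `&` `]a, b[))%E.
  rewrite -lebesgue_measureU //; last 2 first.
  - exact: measurable_sublevelI.
  - rewrite level_bandE; apply/seteqP; split => // s /=.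
    by move=> [[[_ nh] _] [h _]].
  rewrite -[RHS](@lebesgue_measureU_finite _ _ (level (k + 1) `&` `]a, b[)); first last.
  - exact/finite_setIl/finite_level.
  - exact: measurable_sublevelI.
  congr (lebesgue_measure _); rewrite level_bandE.
  rewrite -!setIUl [X in X `&` _ = _]setUC setDUK //.
  move=> s [s01 h]; left; split => //; apply: (lt_trans h).
  by rewrite ltr_pM2r // ltr_int ltrDl.
by rewrite addeK // sublevel_measureE.
Qed.

Lemma level_farE k : level_far g delta k =
  sublevel (k - 1) `|` (`[0, 1]%classic `\` (sublevel (k + 2) `|` level (k + 2))).
Proof.
have e1 : (k - 1)%:~R * delta = k%:~R * delta - delta :> R.
  by rewrite intrB mulrBl mul1r.
have e0 : (k - 1 + 1)%:~R * delta = k%:~R * delta :> R by rewrite subrK.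
have e2 : (k + 1)%:~R * delta = k%:~R * delta + delta :> R.
  by rewrite intrD mulrDl mul1r.
have e3 : (k + 1 + 1)%:~R * delta = k%:~R * delta + 2 * delta :> R.
  by rewrite !intrD; ring.
have e4 : (k + 2)%:~R * delta = k%:~R * delta + 2 * delta :> R.
  by rewrite !intrD; ring.
have d0 := delta_gt0.
apply/seteqP; split => s /=; rewrite /level_far /level_nbhd /level_band
  /sublevel /level /= !in_itv /= e0 e1 e2 e3 e4.
- move=> [s01 nh]; have [lt|ge] := ltP (g s) (k%:~R * delta - delta).
    by left.
  right; split => // h; apply: nh.
  have h2 : g s <= k%:~R * delta + 2 * delta by case: h => -[_]; lra.
  have [h0|h0] := leP (g s) (k%:~R * delta); first by left; left; split => //; lra.
  have [h1|h1] := leP (g s) (k%:~R * delta + delta).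
    by left; right; split => //; lra.
  by right; split => //; lra.
- move=> [[s01 h]|[s01 h]]; split => //.
    by move=> [[[_]|[_]]|[_]]; lra.
  move=> h'; apply: h; rewrite s01.
  have h2 : g s <= k%:~R * delta + 2 * delta by case: h' => [[]|] -[_]; lra.
  by move: h2; rewrite le_eqVlt => /orP[/eqP|] ?; [right|left].
Qed.

Lemma level_far_length k (a b : R) : 0 <= a -> a <= b -> b <= 1 ->
  lebesgue_measure (level_far g delta k `&` `]a, b[) =
  (sublevel_length (k - 1) a b + (b - a - sublevel_length (k + 2) a b))%:E.
Proof.
move=> a0 ab b1.
set up := `[0, 1]%classic `\` (sublevel (k + 2) `|` level (k + 2)).
have mup : measurable (up `&` `]a, b[).
  apply: measurableI => //; apply: measurableD => //.
  by apply: measurableU; [exact: measurable_sublevel|exact: measurable_level].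
rewrite level_farE -/up setIUl lebesgue_measureU //; last 2 first.
- exact: measurable_sublevelI.
- apply/seteqP; split => // s /= [[[s01 lt] _] [[_ nh] _]]; apply: nh; left.
  by split => //; apply: (lt_trans lt); rewrite ltr_pM2r // ltr_int; lia.
rewrite sublevel_measureE [in RHS]EFinD; congr (_ + _)%E.
rewrite EFinB -itv_measure //.
have <- : (lebesgue_measure (up `&` `]a, b[) +
           lebesgue_measure (sublevel (k + 2) `&` `]a, b[) =
           lebesgue_measure (`]a, b[%classic : set R))%E.
  rewrite -lebesgue_measureU //; last 2 first.
  - exact: measurable_sublevelI.
  - by apply/seteqP; split => // s /= [[[_ nh] _] [h _]]; apply: nh; left.
  rewrite -[LHS](@lebesgue_measureU_finite _ _ (level (k + 2) `&` `]a, b[)); first last.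
  - exact/finite_setIl/finite_level.
  - by apply: measurableU => //; exact: measurable_sublevelI.
  congr (lebesgue_measure _); rewrite -!setIUl -setUA [X in X `&` _ = _]setUC setDUK //.
    apply/setIidPr => s /=; rewrite !in_itv /= => /andP[? ?].
    by apply/andP; split; lra.
  by move=> s [] [].
by rewrite sublevel_measureE addeK.
Qed.


Lemma sublevel_length_mono k k' (a b : R) : k <= k' ->
  sublevel_length k a b <= sublevel_length k' a b.
Proof.
move=> kk'; rewrite -lee_fin -!sublevel_measureE.
apply: le_measure; rewrite ?inE; try exact: measurable_sublevelI.
apply: setSI => s [s01 lt]; split => //; apply: (lt_le_trans lt).
by rewrite ler_pM2r // ler_int.
Qed.

Lemma sublevel_length_add k (a b c : R) : a <= b -> b <= c ->
  sublevel_length k a c = sublevel_length k a b + sublevel_length k b c.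
Proof.
move=> ab bc; apply: EFin_inj; rewrite EFinD -!sublevel_measureE.
rewrite -lebesgue_measureU; try exact: measurable_sublevelI; last first.
  apply/seteqP; split => // s /= [[_ +] [_]]; rewrite !in_itv /=.
  by move=> /andP[_ sb] /andP[bs _]; lra.
rewrite -[RHS](@lebesgue_measureU_finite _ _
  ([set b] `&` (sublevel k `&` `]a, c[))); first last.
- exact: finite_setIl.
- by apply: measurableU; exact: measurable_sublevelI.
congr (lebesgue_measure _); apply/seteqP; split => s /=; rewrite !in_itv /=.
- move=> [ls /andP[as_ sc]].
  have [sb|bs|sb] := ltgtP s b.
  + by left; left; split => //; apply/andP.
  + by left; right; split => //; apply/andP.
  + by right; do 2 split => //; apply/andP.
- move=> [[[ls /andP[as_ sb]]|[ls /andP[bs sc]]]|[_ //]].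
    by split => //; rewrite as_ (lt_le_trans sb).
  by split => //; rewrite sc (le_lt_trans ab).
Qed.

Lemma sublevel_length_le k (a b : R) : a <= b -> sublevel_length k a b <= b - a.
Proof.
move=> ab; rewrite -lee_fin -sublevel_measureE -itv_measure //.
apply: le_measure; rewrite ?inE; last exact: subIsetr.
  exact: measurable_sublevelI.
exact: measurable_itv.
Qed.

Lemma sublevel_length0 k (a b : R) :
  (forall s, a < s -> s < b -> s \in `[0, 1] -> k%:~R * delta <= g s) ->
  sublevel_length k a b = 0.
Proof.
move=> h; rewrite /sublevel_length (_ : _ `&` _ = set0) ?measure0 //.
apply/seteqP; split => // s /= [[s01 lt]].
rewrite in_itv /= => /andP[as_ sb].
by have := h s as_ sb s01; rewrite leNgt lt.
Qed.

Lemma sublevel_length_full k (a b : R) : 0 <= a -> a <= b -> b <= 1 ->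
  (forall s, a < s -> s < b -> g s < k%:~R * delta) ->
  sublevel_length k a b = b - a.
Proof.
move=> a0 ab b1 h; apply: EFin_inj; rewrite -sublevel_measureE -itv_measure //.
congr (lebesgue_measure _); apply/setIidPr => s /=.
rewrite in_itv /= => /andP[as_ sb]; split; last exact: h.
by rewrite in_itv /=; apply/andP; split; lra.
Qed.

Lemma sublevel_level_profile (M : nat) :
  g 0 = 0 -> g 1 = M%:R * delta -> level_profile M sublevel_length.
Proof.
move=> g0 g1.
have d0 := delta_gt0.
have [e e0 uc] := segment_unif_continuous delta_gt0 g_cont.
pose r := Num.min (e / 2) 1.
have r0 : 0 < r by rewrite /r lt_min; apply/andP; split; lra.
have r1 : r <= 1 by rewrite /r ge_min lexx orbT.
have re : r < e.
  by rewrite /r; apply: (@le_lt_trans _ _ (e / 2)); [rewrite ge_min lexx|lra].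
split.
- by move=> *; exact/fine_ge0/measure_ge0.
- by move=> *; exact: sublevel_length_le.
- by move=> *; exact: sublevel_length_mono.
- by move=> *; exact: sublevel_length_add.
- exists e => // k a b a0 ab b1 be.
  have [[s [/andP[as_ sb] lt]]|none] :=
    pselect (exists s, a < s < b /\ g s < k%:~R * delta).
    right; apply: sublevel_length_full => // t at_ tb.
    have : `|g s - g t| < delta.
      by apply: uc; rewrite ?ltr_norml; try (apply/andP; split); lra.
    by rewrite ltr_norml intrD mulrDl mul1r => /andP[? ?]; lra.
  left; apply: sublevel_length0 => s as_ sb s01.
  rewrite leNgt; apply/negP => lt; apply: none; exists s.
  by split => //; rewrite as_ sb.
- move=> a b *; apply: sublevel_length0 => s _ _ s01.
  by rewrite mul0r; exact: g_ge0.
- have [c c01 gmax] := EVT_max ler01 g_cont.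
  exists (Num.truncn (g c / delta)).+1.
  rewrite -[RHS]subr0; apply: sublevel_length_full => // s s0 s1.
  apply: (@le_lt_trans _ _ (g c)).
    by apply: gmax; rewrite in_itv /=; apply/andP; split; lra.
  by rewrite -ltr_pdivrMr //; exact: truncnS_gt.
- exists r; first by rewrite r0 r1.
  rewrite -[RHS]subr0; apply: sublevel_length_full => //; try lra.
  move=> s s0 sr.
  have : `|g s - g 0| < delta.
    by apply: uc; rewrite ?ltr_norml; try (apply/andP; split); lra.
  by rewrite ltr_norml g0 => /andP[? ?]; lra.
- exists r; first by rewrite r0 r1.
  apply: sublevel_length0 => s rs s1 _.
  have : `|g s - g 1| < delta.
    by apply: uc; rewrite ?ltr_norml; try (apply/andP; split); lra.
  by rewrite ltr_norml g1 intrB mulrBl mul1r => /andP[? ?]; lra.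
Qed.

End Sublevels.

(** * The theorem *)

Lemma size_le_counting (R : realType) (A : set nat) (u : seq nat) :
  uniq u -> (forall k, k \in u -> A k) ->
  ((size u)%:R%:E <= counting A :> \bar R)%E.
Proof.
move=> uu uA; rewrite /counting; case: ifPn => [/asboolP finA|_]; last exact: leey.
rewrite lee_fin ler_nat; apply: uniq_leq_size => // k ku.
by rewrite in_fset_set // inE; exact: uA.
Qed.

Unset Implicit Arguments.

Theorem theorem2p3 (R : realType) (delta : R) (M : nat) (g : R -> R)
    (delta_gt0 : 0 < delta)
    (M_gt100 : (100 < M)%N)
    (g_cont : {within `[0, 1]%classic, continuous g})
    (g_ge0 : forall s, s \in `[0, 1] -> 0 <= g s)
    (g0 : g 0 = 0)
    (g1 : g 1 = M%:R * delta)
    (g_level : forall k : nat,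
       finite_set [set s : R | s \in `[0, 1] /\ g s = k%:R * delta]) :
  ((M%:R / 100)%:E <= counting (satisfied g delta) :> \bar R)%E \/
  log_singularity g delta M.
Proof.
set l := sublevel_length delta g.
have lP : level_profile M l by exact: sublevel_level_profile.
have bandE k (a b : R) : lebesgue_measure (level_band g delta k `&` `]a, b[) =
    (l (k + 1) a b - l k a b)%:E by exact: level_band_length.
have farE k (a b : R) : 0 <= a -> a <= b -> b <= 1 ->
    lebesgue_measure (level_far g delta k `&` `]a, b[) =
    (l (k - 1) a b + (b - a - l (k + 2) a b))%:E.
  by move=> *; exact: level_far_length.
have fullE alpha k (a b : R) : a <= b ->
    full g delta alpha k `]a, b[%classic <->
    alpha * (b - a) < l (k + 1) a b - l k a b.
  by move=> ab; rewrite /full bandE itv_measure // -EFinM lte_fin.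
have emptyE alpha k (a b : R) : 0 <= a -> a <= b -> b <= 1 ->
    empty g delta alpha k `]a, b[%classic <->
    alpha * (b - a) < l (k - 1) a b + (b - a - l (k + 2) a b).
  by move=> a0 ab b1; rewrite /empty farE // itv_measure // -EFinM lte_fin.
have sat k : ~ unseen_or_near l k%:Z -> satisfied g delta k.
  move=> /existsNP[a] /existsNP[b] /not_implyP[a0] /not_implyP[ab].
  move=> /not_implyP[b1] /not_orP[/negP + /negP]; rewrite -!ltNge => h1 h2.
  exists a, b; split => //.
  - by move=> s; rewrite /= !in_itv /= => /andP[? ?]; apply/andP; split; lra.
  - by apply/fullE; [exact: ltW|lra].
  - by apply/emptyE => //; [exact: ltW|lra].
have [|few] := leP (M%:R / 100)%:E (counting (satisfied g delta)); first by left.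
right.
have [|m [k [tau [mM kincr tau01 decay growth]]]] :=
  profile_log_singularity lP M_gt100.
  move=> u uu usat; rewrite -(ltr_nat R) natrM mulrC -ltr_pdivlMr // -lte_fin.
  by apply: le_lt_trans few; apply: size_le_counting => // k /usat /sat.
exists m, k, tau; split => //.
case: growth => growth; [left|right] => i.
- have [fl em] := growth i; have /andP[t0 t1] := tau01 i.
  split; first by apply/fullE; [lra|exact: fl].
  have em' j : -1 <= j <= 1 ->
      empty g delta (3 / 100) (k i - M%:Z + j) `]0, (tau i)[%classic.
    by move=> /em ej; apply/emptyE => //; exact: ltW.
  split; [exact: (em' (-1))|have := em' 0|exact: em'].
  by rewrite addr0; exact.
- have [fl em] := growth i; have /andP[t0 t1] := tau01 (rev_ord i).
  split; first by apply/fullE; [lra|exact: fl].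
  have em' j : -1 <= j <= 1 ->
      empty g delta (3 / 100) (k i + M%:Z + j)
        `](1 - tau (rev_ord i)), 1[%classic.
    by move=> /em ej; apply/emptyE => //; lra.
  split; [exact: (em' (-1))|have := em' 0|exact: em'].
  by rewrite addr0; exact.
Qed.
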